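(* In the three-body problem on the hyperbolic plane $\mathcal{H}^2$ (of curvature $-1$), there are no Lagrangian hyperbolic relative equilibria; that is, there is no hyperbolic relative equilibrium $q(t)=(q_1(t),q_2(t),q_3(t))$ for which the hyperbolic distance among the three masses is the same, $d(q_1,q_2)=d(q_2,q_3)=d(q_3,q_1)$.
   Context: Model of the hyperbolic plane. $\mathcal{H}^2$ denotes the complete, simply connected two-dimensional space of constant curvature $-1$. It is represented by the Weierstrass model $\mathbb{L}^2=\{(x,y,z)\in\mathbb{R}^3: x^2+y^2-z^2=-1,\ z>0\}$, where $\mathbb{R}^3$ carries the Lorentz inner product $a\odot b=a_xb_x+a_yb_y-a_zb_z$. The hyperbolic distance is $d(p,q)=\cosh^{-1}(-p\odot q)$. The three-body problem. Point particles with positive masses $m_1,m_2,m_3$ and pairwise distinct positions $q_1(t),q_2(t),q_3(t)\in\mathbb{L}^2$ move according to $$\ddot q_i=\sum_{j\ne i}\frac{m_j\,\bigl(q_j+(q_i\odot q_j)q_i\bigr)}{\bigl(-1+(q_i\odot q_j)^2\bigr)^{3/2}}+(\dot q_i\odot\dot q_i)\,q_i,\qquad i=1,2,3.$$ Hyperbolic relative equilibria. Let $\mathrm{Lor}(\mathbb{L}^2,\odot)$ be the group of linear transformations of $\mathbb{R}^3$ of determinant $1$ that preserve $\odot$ and map $\mathbb{L}^2$ to itself. For $s\in\mathbb{R}$ let $$A(s)=\begin{pmatrix}1&0&0\\0&\cosh s&\sinh s\\0&\sinh s&\cosh s\end{pmatrix}.$$ A hyperbolic relative equilibrium is a solution of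 the equations of motion of the form $q_i(t)=P\,A(\omega t)\,P^{-1}q_i(0)$ for all $t\in\mathbb{R}$ and all $i=1,2,3$, for some $P\in\mathrm{Lor}(\mathbb{L}^2,\odot)$ and some constant $\omega\neq 0$ (the same $P$ and $\omega$ for all $i$). It is called Lagrangian if the three mutual hyperbolic distances are equal. *)

(* Defs.v *)
From mathcomp Require Import all_boot all_order all_algebra.
From mathcomp Require Import all_classical all_reals all_analysis.

Set Implicit Arguments.
Unset Strict Implicit.
Unset Printing Implicit Defensive.

Import Order.TTheory GRing.Theory Num.Theory.
Import numFieldNormedType.Exports.

Local Open Scope classical_set_scope.
Local Open Scope ring_scope.

Section Hyperbolic.
Variable R : realType.
Implicit Types (s t x y : R) (a b p : 'cV[R]_3) (m : 'I_3 -> R)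
  (q : 'I_3 -> R -> 'cV[R]_3).

Definition cosh x : R := (expR x + expR (- x)) / 2.
Definition sinh x : R := (expR x - expR (- x)) / 2.

(* Inverse of the restriction of cosh to [0, +oo[; meaningful for 1 <= y,
   see arcosh_ge0 and arcoshK. *)
Definition arcosh y : R := ln (y + Num.sqrt (y ^+ 2 - 1)).

Lemma arcosh_ge0 y : 1 <= y -> 0 <= arcosh y.
Proof.
move=> y1; rewrite /arcosh ln_ge0//.
by rewrite -[leLHS]addr0 lerD// sqrtr_ge0.
Qed.

Lemma arcoshK y : 1 <= y -> cosh (arcosh y) = y.
Proof.
move=> y1; rewrite /cosh /arcosh; set r := Num.sqrt _.
have r0 : 0 <= r by exact: sqrtr_ge0.
have y0 : 0 < y by exact: lt_le_trans y1.
have r2 : r ^+ 2 = y ^+ 2 - 1.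
  by rewrite sqr_sqrtr// subr_ge0 expr_ge1// ltW.
have yr : 0 < y + r by exact: ltr_pwDl.
rewrite expRN lnK ?posrE//.
have -> : (y + r)^-1 = y - r.
  apply: (mulIf (lt0r_neq0 yr)); rewrite mulVf ?lt0r_neq0//.
  by rewrite -subr_sqr r2 opprB addrC subrK.
by rewrite addrACA subrr addr0 -mulr2n -[y *+ 2]mulr_natr mulfK ?pnatr_eq0.
Qed.

(* The coordinates x, y, z of a are a 0 0, a 1 0 and a 2 0. *)
Definition lorentz a b : R :=
  a 0 0 * b 0 0 + a 1 0 * b 1 0 - a 2 0 * b 2 0.

Definition L2 : set 'cV[R]_3 := [set p | lorentz p p = -1 /\ 0 < p 2 0].

Definition hdist p p' : R := arcosh (- lorentz p p').

Definition Lor : set 'M[R]_3 :=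
  [set P | [/\ \det P = 1,
               forall a b, lorentz (P *m a) (P *m b) = lorentz a b &
               forall p, L2 p -> L2 (P *m p)]].

Definition hrot s : 'M[R]_3 :=
  \matrix_(i < 3, j < 3)
    nth 0 (nth [::] [:: [:: 1; 0;      0];
                        [:: 0; cosh s; sinh s];
                        [:: 0; sinh s; cosh s]] i) j.

Definition attraction m (i : 'I_3) (x : 'I_3 -> 'cV[R]_3) : 'cV[R]_3 :=
  \sum_(j < 3 | j != i)
    (m j / ((-1 + lorentz (x i) (x j) ^+ 2) `^ (3 / 2))) *:
      (x j + lorentz (x i) (x j) *: x i).

(* derive1 is total, so differentiability is required explicitly. *)
Definition solution m q : Prop :=
  forall t,
    [/\ forall i, L2 (q i t),
        forall i j, i != j -> q i t != q j t,
        forall i, derivable (q i) t 1 /\ derivable (derive1 (q i)) t 1 &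
        forall i, derive1n 2 (q i) t =
          attraction m i (q ^~ t)
          + lorentz (derive1 (q i) t) (derive1 (q i) t) *: q i t].

Definition hyperbolic_relative_equilibrium m q : Prop :=
  solution m q /\
  exists (P : 'M[R]_3) (omega : R),
    [/\ Lor P, omega != 0 &
        forall i t, q i t = P *m hrot (omega * t) *m invmx P *m q i 0].

Definition lagrangian q : Prop :=
  forall t, hdist (q 0 t) (q 1 t) = hdist (q 1 t) (q 2 t) /\
            hdist (q 1 t) (q 2 t) = hdist (q 2 t) (q 0 t).

End Hyperbolic.

(* Main.v *)
Require Import Defs.
From mathcomp Require Import all_boot all_order all_algebra.
From mathcomp Require Import all_classical all_reals all_analysis.
From mathcomp Require Import ring lra.
Import Order.TTheory GRing.Theory Num.Theory.
Import numFieldNormedType.Exports.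
Local Open Scope ring_scope.

(** Only the instant t = 0 matters.  Put u_i = P^-1 q_i(0) and let J be the
    generator of the boosts A(s), so J(x, y, z) = (0, z, y).  The motion
    q_i(t) = P A(w t) u_i turns the equations of motion at t = 0 into

      w^2 J^2 u_i = (attraction on u_i) + w^2 (J u_i . J u_i) u_i,

    where J^2 u_i = (0, y_i, z_i) and J u_i . J u_i = z_i^2 - y_i^2 = 1 + x_i^2
    ([equilibrium_equation]).

    If the three distances coincide, all mutual products u_i . u_j are equal to
    some -c with c > 1, and every denominator of the attraction has the same
    value 1/k.  Hence the attraction on u_i is k (S - (m_i + c (M - m_i)) u_i),
    with S the sum of the m_j u_j and M the total mass: up to a multiple of u_i
    it does not depend on i.  In the y and z coordinates the equation becomes

      lam_i (y_i, z_i) = k (S_y, S_z)   with   lam_i a scalar.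

    Since S_z and z_i are positive, so is lam_i, and the pairs (y_i, z_i) are
    all proportional to (S_y, S_z).  The three points therefore lie in one
    plane through the origin, that is, on one geodesic
    ([coplanar_of_equilibrium]).  But three equidistant points of the
    hyperbolic plane are linearly independent, because their Gram matrix, with
    -1 on the diagonal and -c elsewhere, is invertible
    ([equidistant_free]). *)

(** * The Lorentz product and the hyperbolic distance *)

Lemma ord3P (i : 'I_3) : [\/ i = 0, i = 1 | i = 2].
Proof.
case: i => [[|[|[|//]]] lt_i3].
- by constructor 1; apply: val_inj.
- by constructor 2; apply: val_inj.
- by constructor 3; apply: val_inj.
Qed.

Lemma sum_ord3 (V : nmodType) (F : 'I_3 -> V) : \sum_j F j = F 0 + F 1 + F 2.
Proof.
rewrite !big_ord_recl big_ord0 addr0 addrA.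
by congr (_ + F _ + F _); apply: val_inj.
Qed.

Lemma lorentzZ (R : realType) (k : R) (a b : 'cV[R]_3) :
  lorentz (k *: a) (k *: b) = k ^+ 2 * lorentz a b.
Proof. by rewrite /lorentz !mxE; ring. Qed.

Lemma lorentz_suml (R : realType) (n : nat) (w : 'I_n -> R)
    (u : 'I_n -> 'cV[R]_3) (b : 'cV[R]_3) :
  lorentz (\sum_j w j *: u j) b = \sum_j w j * lorentz (u j) b.
Proof.
rewrite /lorentz !summxE !mulr_suml -big_split -sumrB /=.
by apply: eq_bigr => j _; rewrite !mxE; ring.
Qed.

Lemma lorentzC (R : realType) (a b : 'cV[R]_3) : lorentz a b = lorentz b a.
Proof. by rewrite /lorentz; ring. Qed.

Lemma col3P (R : realType) (a b : 'cV[R]_3) :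
  a 0 0 = b 0 0 -> a 1 0 = b 1 0 -> a 2 0 = b 2 0 -> a = b.
Proof.
move=> e0 e1 e2; apply/matrixP => i j; rewrite (ord1 j).
by case: (ord3P i) => ->.
Qed.

(** The reversed Cauchy-Schwarz inequality, in strict form.  On the hyperboloid
    (z z')^2 exceeds (1 + x x' + y y')^2 by
    (x - x')^2 + (y - y')^2 + (x y' - x' y)^2. *)
Lemma lorentz_L2_lt (R : realType) (p p' : 'cV[R]_3) :
  L2 p -> L2 p' -> p != p' -> 1 < - lorentz p p'.
Proof.
case=> np zp [np' zp'] neq_pp'; rewrite ltNge; apply/negP => le1.
move: np np' le1 zp zp'; rewrite /lorentz => np np' le1 zp zp'.
set x := p 0 0 in np le1 *; set y := p 1 0 in np le1 *.
set z := p 2 0 in np le1 zp *.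
set x' := p' 0 0 in np' le1 *; set y' := p' 1 0 in np' le1 *.
set z' := p' 2 0 in np' le1 zp' *.
have zz'0 : 0 < z * z' by rewrite mulr_gt0.
have lezz : z * z' <= 1 + x * x' + y * y' by lra.
have lesq : (z * z') ^+ 2 <= (1 + x * x' + y * y') ^+ 2.
  by rewrite ler_sqr ?nnegrE; lra.
have z2 : z ^+ 2 = 1 + x ^+ 2 + y ^+ 2 by lra.
have z'2 : z' ^+ 2 = 1 + x' ^+ 2 + y' ^+ 2 by lra.
have sos : (x - x') ^+ 2 + (y - y') ^+ 2 + (x * y' - x' * y) ^+ 2 <= 0.
  move: lesq; rewrite exprMn z2 z'2 -subr_le0; congr (_ <= 0); ring.
have sq0 (a : R) : 0 <= a ^+ 2 by rewrite sqr_ge0.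
have ex : x = x'.
  apply/eqP; rewrite -subr_eq0 -sqrf_eq0 eq_le sq0 andbT.
  by have := sq0 (y - y'); have := sq0 (x * y' - x' * y); lra.
have ey : y = y'.
  apply/eqP; rewrite -subr_eq0 -sqrf_eq0 eq_le sq0 andbT.
  by have := sq0 (x - x'); have := sq0 (x * y' - x' * y); lra.
have ez : z = z'.
  by apply: (pexpIrn (n := 2)); rewrite ?nnegrE ?ltW // z2 z'2 ex ey.
by move/eqP: neq_pp'; apply; apply: col3P.
Qed.

Lemma hdist_inj (R : realType) (p p' r r' : 'cV[R]_3) :
  1 <= - lorentz p p' -> 1 <= - lorentz r r' ->
  hdist p p' = hdist r r' -> lorentz p p' = lorentz r r'.
Proof.
move=> h h' /(congr1 (@cosh R)); rewrite /hdist !arcoshK //; exact: oppr_inj.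
Qed.

(** Pairing a relation between the points with [u i] gives
    (c - 1) w_i = c s, where s is the sum of the coefficients.  Summing over i,
    (1 + c (n - 1)) s = 0, so s = 0, and then every w_i vanishes. *)
Lemma equidistant_free (R : realType) (n : nat) (c : R)
    (u : 'I_n -> 'cV[R]_3) (w : 'I_n -> R) :
  1 < c -> (forall i, lorentz (u i) (u i) = -1) ->
  (forall i j, i != j -> lorentz (u i) (u j) = - c) ->
  \sum_j w j *: u j = 0 -> forall i, w i = 0.
Proof.
move=> c1 nu cu sum0.
set s := \sum_j w j.
have row i : (c - 1) * w i = c * s.
  have : lorentz (\sum_j w j *: u j) (u i) = 0.
    by rewrite sum0 /lorentz !mxE; ring.
  rewrite lorentz_suml (bigD1 i) //= nu.
  rewrite (eq_bigr (fun j => w j * - c)); last by move=> j ji; rewrite cu.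
  rewrite -mulr_suml => e; rewrite /s (bigD1 i) //=; lra.
have s0 : s = 0.
  have e : (c - 1) * s = (c * s) *+ n.
    rewrite {1}/s mulr_sumr (eq_bigr (fun=> c * s)) => [|i _]; last exact: row.
    by rewrite sumr_const card_ord.
  case: n => [|n] in u w nu cu sum0 s row e *; first by rewrite /s big_ord0.
  have : (1 + c * n%:R) * s = 0.
    by move: e; rewrite -mulr_natr -natr1; lra.
  move/eqP; rewrite mulf_eq0 => /orP[/eqP h|/eqP//].
  by have : 0 <= c * n%:R by [rewrite mulr_ge0 // ltW // (lt_trans _ c1)]; lra.
move=> i; have := row i; rewrite s0 mulr0 => /eqP.
by rewrite mulf_eq0 subr_eq0 (gt_eqF c1) => /eqP.
Qed.

(** * Lorentz transformations and boosts *)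

Lemma Lor_unit {R : realType} {P : 'M[R]_3} : Lor P -> P \in unitmx.
Proof. by case=> detP _ _; rewrite unitmxE detP unitr1. Qed.

(** An isometry preserves the two-sheeted hyperboloid; a point of the lower
    sheet cannot be sent to the upper one, since its antipode would be sent to
    the lower one. *)
Lemma Lor_L2 (R : realType) (P : 'M[R]_3) (p : 'cV[R]_3) :
  Lor P -> L2 (P *m p) -> L2 p.
Proof.
case=> _ isoP L2P [nPp zPp].
have np : lorentz p p = -1 by rewrite -nPp isoP.
split=> //; rewrite ltNge le_eqVlt; apply/negP => /orP[/eqP z0|zN].
  move: np; rewrite /lorentz z0.
  by have := sqr_ge0 (p 0 0); have := sqr_ge0 (p 1 0); rewrite !expr2; lra.
have /L2P[_] : L2 (- p).
  by split; [rewrite -np /lorentz !mxE; ring | rewrite mxE oppr_gt0].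
by rewrite mulmxN mxE; lra.
Qed.

Lemma attraction_Lor (R : realType) (m : 'I_3 -> R) (P : 'M[R]_3)
    (x : 'I_3 -> 'cV[R]_3) (i : 'I_3) :
  Lor P -> attraction m i (fun j => P *m x j) = P *m attraction m i x.
Proof.
case=> _ isoP _; rewrite /attraction mulmx_sumr; apply: eq_bigr => j _.
by rewrite isoP -scalemxAr mulmxDr -scalemxAr.
Qed.

(** The infinitesimal generator of the one-parameter group [hrot]. *)
Definition boost_gen {R : realType} (a : 'cV[R]_3) : 'cV[R]_3 :=
  \col_i nth 0 [:: 0; a 2 0; a 1 0] i.

(** The exponential series of the generator J collapses because J^3 = J.  This
    form isolates the dependence on [s] in two scalar factors, so that
    differentiating the motion only involves the hyperbolic functions. *)
Lemma hrotE (R : realType) (s : R) (a : 'cV[R]_3) :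
  hrot s *m a =
    (a - boost_gen (boost_gen a)) + cosh s *: boost_gen (boost_gen a)
    + sinh s *: boost_gen a.
Proof.
by apply: col3P; rewrite mxE sum_ord3 !mxE /= ?mxE /=; ring.
Qed.

Lemma is_derive_cosh (R : realType) (x : R) : is_derive x 1 (@cosh R) (sinh x).
Proof.
have d1 := is_derive_expR x.
have d2 := is_derive1_comp (is_derive_expR (- x)) (is_deriveNid x (1 : R)).
have -> : @cosh R = 2^-1 \*: (expR + (expR \o -%R)).
  by apply/funext => y; rewrite /cosh /= mulrC.
apply: is_derive_eq.
by rewrite /sinh /GRing.scale /=; ring.
Qed.

Lemma is_derive_sinh (R : realType) (x : R) : is_derive x 1 (@sinh R) (cosh x).
Proof.
have d1 := is_derive_expR x.
have d2 := is_derive1_comp (is_derive_expR (- x)) (is_deriveNid x (1 : R)).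
have -> : @sinh R = 2^-1 \*: (expR - (expR \o -%R)).
  by apply/funext => y; rewrite /sinh /= mulrC.
apply: is_derive_eq.
by rewrite /cosh /GRing.scale /=; ring.
Qed.

Lemma is_derive_scale_vec (R : realType) (V : normedModType R) (f : R -> R)
    (t df : R) (v : V) :
  is_derive t 1 f df -> is_derive t 1 (fun x => f x *: v) (df *: v).
Proof.
case=> exf df_val.
have cf : ((fun h : R => h^-1 *: (f (h *: 1 + t) - f t)) @ 0^'
    --> df)%classic.
  by rewrite -df_val; exact: exf.
have cv : ((fun h : R => h^-1 *: (f (h *: 1 + t) *: v - f t *: v)) @ 0^'
    --> df *: v)%classic.
  under eq_fun do rewrite -scalerBl scalerA.
  exact: cvgZr_tmp cf.
apply: DeriveDef; first by apply/cvg_ex; exists (df *: v).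
exact: cvg_lim cv.
Qed.

(** The derivative is written in the same shape as the function, so that a
    second application gives the second derivative. *)
Lemma derive1_hyperbolic (R : realType) (w : R) (a b c : 'cV[R]_3) :
  derive1 (fun t => a + cosh (w * t) *: b + sinh (w * t) *: c) =
  (fun t => 0 + cosh (w * t) *: (w *: c) + sinh (w * t) *: (w *: b)).
Proof.
apply/funext => t; rewrite derive1E.
have dw : is_derive t (1 : R) ( *%R w ) w.
  have -> : *%R w = w \*: (@id R) by [].
  by apply: is_derive_eq; rewrite /GRing.scale /= mulr1.
have dc := is_derive_scale_vec _ _ _ _ _ b
  (is_derive1_comp (is_derive_cosh _ (w * t)) dw).
have ds := is_derive_scale_vec _ _ _ _ _ c
  (is_derive1_comp (is_derive_sinh _ (w * t)) dw).
have d := is_deriveD (is_deriveD (is_derive_cst a t (1 : R)) dc) ds.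
by rewrite (derive_val (is_derive := d)) !scalerA add0r [in RHS]add0r addrC.
Qed.

(** * The equations of motion at the initial instant *)

(** The second derivative of P A(w t) u_i at 0 is w^2 P J^2 u_i and the velocity
    is w P J u_i.  As P preserves the Lorentz product, it factors out of every
    term and can be cancelled. *)
Lemma equilibrium_equation (R : realType) (m : 'I_3 -> R)
    (q : 'I_3 -> R -> 'cV[R]_3) (P : 'M[R]_3) (w : R) :
  solution m q -> Lor P ->
  (forall i t, q i t = P *m hrot (w * t) *m invmx P *m q i 0) ->
  let u i := invmx P *m q i 0 in
  forall i, w ^+ 2 *: boost_gen (boost_gen (u i)) =
    attraction m i u
    + (w ^+ 2 * lorentz (boost_gen (u i)) (boost_gen (u i))) *: u i.
Proof.
move=> sol LP qE u i.
have uP := Lor_unit LP.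
have Pu j : q j 0 = P *m u j by rewrite mulKVmx.
have qcurve : q i = fun t => P *m (u i - boost_gen (boost_gen (u i)))
    + cosh (w * t) *: (P *m boost_gen (boost_gen (u i)))
    + sinh (w * t) *: (P *m boost_gen (u i)).
  apply/funext => t; rewrite qE -2!mulmxA -/(u i) hrotE.
  by rewrite !mulmxDr -!scalemxAr.
have c0 : cosh (w * 0) = 1 by rewrite /cosh mulr0 oppr0 expR0; lra.
have s0 : sinh (w * 0) = 0 by rewrite /sinh mulr0 oppr0 subrr mul0r.
have [_ _ _ /(_ i)] := sol 0.
have -> : q^~ 0 = fun j => P *m u j by apply/funext => j; exact: Pu.
rewrite attraction_Lor // Pu qcurve /derive1n /= !derive1_hyperbolic.
rewrite c0 s0 !scale1r !scale0r !add0r !addr0 lorentzZ.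
case: (LP) => _ isoP _; rewrite isoP scalerA -expr2 => e.
apply: (can_inj (mulKmx uP)).
by rewrite mulmxDr -!scalemxAr.
Qed.

(** * Equidistant configurations *)

(** The pair (y, z) found is (S_y, S_z), the last two coordinates of the sum of
    the m_j u_j. *)
Lemma coplanar_of_equilibrium (R : realType) (m : 'I_3 -> R) (w c : R)
    (u : 'I_3 -> 'cV[R]_3) :
  (forall i, 0 < m i) -> 1 < c -> (forall i, L2 (u i)) ->
  (forall i j, i != j -> lorentz (u i) (u j) = - c) ->
  (forall i, w ^+ 2 *: boost_gen (boost_gen (u i)) =
    attraction m i u
    + (w ^+ 2 * lorentz (boost_gen (u i)) (boost_gen (u i))) *: u i) ->
  exists y z, 0 < z /\ forall i, z * u i 1 0 = y * u i 2 0.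
Proof.
move=> m0 c1 Lu cu eqm.
pose k := ((-1 + c ^+ 2) `^ (3 / 2))^-1.
have k0 : 0 < k.
  rewrite invr_gt0 powR_gt0 // addrC subr_gt0 expr_gt1 //.
  by rewrite ltW // (lt_trans _ c1).
pose S := \sum_j m j *: u j.
pose M := \sum_j m j.
pose lam i := k * (m i + c * (M - m i)) - w ^+ 2 * u i 0 0 ^+ 2.
(* Equal distances make the pull from the other two bodies a common vector S
   corrected by a multiple of u i. *)
have attrE i : attraction m i u =
    k *: (S - (m i + c * (M - m i)) *: u i).
  have SE : S = m i *: u i + \sum_(j | j != i) m j *: u j.
    by rewrite /S (bigD1 i).
  have ME : M = m i + \sum_(j | j != i) m j by rewrite /M (bigD1 i).
  rewrite /attraction SE ME [m i + _ - m i]addrC addKr.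
  rewrite (eq_bigr (fun j => k *: (m j *: u j) - (m j * (k * c)) *: u i)).
    rewrite sumrB -scaler_sumr -scaler_suml -mulr_suml.
    by apply/matrixP => r s; rewrite !mxE; ring.
  move=> j ji; rewrite cu 1?eq_sym // sqrrN -/k.
  by apply/matrixP => r s; rewrite !mxE; ring.
have u2 i : u i 0 0 ^+ 2 + u i 1 0 ^+ 2 - u i 2 0 ^+ 2 = -1.
  by have [<- _] := Lu i; rewrite /lorentz; ring.
have boost2 i : lorentz (boost_gen (u i)) (boost_gen (u i)) = 1 + u i 0 0 ^+ 2.
  by rewrite /lorentz !mxE /=; have := u2 i; lra.
(* On the y and z coordinates J^2 is the identity, so its term cancels the 1 in
   J u_i . J u_i = 1 + x_i^2, leaving the scalar lam i. *)
have lamy i : lam i * u i 1 0 = k * S 1 0.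
  have /matrixP/(_ 1 0) := eqm i.
  by rewrite attrE boost2 !mxE /= /lam; lra.
have lamz i : lam i * u i 2 0 = k * S 2 0.
  have /matrixP/(_ 2 0) := eqm i.
  by rewrite attrE boost2 !mxE /= /lam; lra.
have u20 i : 0 < u i 2 0 by have [] := Lu i.
have S0 : 0 < S 2 0.
  rewrite /S summxE (bigD1 0) //= mxE ltr_pwDl ?mulr_gt0 // sumr_ge0 // => j _.
  by rewrite mxE ltW // mulr_gt0.
have lam0 i : 0 < lam i by rewrite -(pmulr_lgt0 _ (u20 i)) lamz mulr_gt0.
exists (S 1 0), (S 2 0); split=> // i.
apply: (mulfI (lt0r_neq0 (lam0 i))).
by rewrite mulrCA lamy mulrCA [RHS]mulrCA lamz; ring.
Qed.

(** The covector (0, z, -y) would annihilate the matrix whose columns are the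
    three points; its determinant would vanish, giving a nontrivial linear
    relation between equidistant points. *)
Lemma not_coplanar_of_equidistant (R : realType) (c y z : R)
    (u : 'I_3 -> 'cV[R]_3) :
  1 < c -> (forall i, lorentz (u i) (u i) = -1) ->
  (forall i j, i != j -> lorentz (u i) (u j) = - c) ->
  0 < z -> ~ (forall i, z * u i 1 0 = y * u i 2 0).
Proof.
move=> c1 nu cu z0 uyz.
pose U := \matrix_(i < 3, j < 3) u i j 0.
have /det0P[w w0 wU] : \det U == 0.
  rewrite -det_tr; apply/det0P.
  exists (\row_j nth 0 [:: 0; z; - y] j).
    apply/eqP => /matrixP/(_ 0 1); rewrite !mxE /= => e.
    by move: z0; rewrite e ltxx.
  apply/matrixP => i j; rewrite mxE sum_ord3 !mxE /=.
  by rewrite uyz; ring.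
have sum0 : \sum_j w 0 j *: u j = 0.
  apply/matrixP => r s; rewrite (ord1 s) summxE mxE.
  have /matrixP/(_ 0 r) := wU; rewrite mxE [RHS]mxE; apply: etrans.
  by apply: eq_bigr => j _; rewrite !mxE.
have w_0 := equidistant_free _ _ _ _ _ c1 nu cu sum0.
by move/eqP: w0; apply; apply/matrixP => r j; rewrite (ord1 r) w_0 mxE.
Qed.

Lemma equilateral3 (R : realType) (f : 'I_3 -> 'I_3 -> R) :
  (forall i j, f i j = f j i) -> f 0 1 = f 1 2 -> f 1 2 = f 2 0 ->
  forall i j, i != j -> f i j = f 0 1.
Proof.
move=> fC e1 e2.
have e3 : f 2 0 = f 0 1 by rewrite e1 e2.
move=> i j.
by case: (ord3P i) => ->; case: (ord3P j) => -> //= _;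
  rewrite ?e3 -?e1 // fC ?e3 -?e1.
Qed.

Theorem corollary4 (R : realType) (m : 'I_3 -> R) (hm : forall i, 0 < m i) :
  ~ exists q : 'I_3 -> R -> 'cV[R]_3,
      hyperbolic_relative_equilibrium m q /\ lagrangian q.
Proof.
case=> q [[sol [P [w [LP _ qE]]]] lag].
have eqm := equilibrium_equation _ _ _ _ _ sol LP qE.
set u := (fun i => invmx P *m q i 0) in eqm.
have Pu j : q j 0 = P *m u j by rewrite mulKVmx ?Lor_unit.
have [Lq neq_q _ _] := sol 0.
have lqu i j : lorentz (q i 0) (q j 0) = lorentz (u i) (u j).
  by rewrite !Pu; case: LP => _ isoP _; rewrite isoP.
have Lu i : L2 (u i) by apply: (Lor_L2 _ _ _ LP); rewrite -Pu.
have gt1 i j : i != j -> 1 < - lorentz (u i) (u j).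
  by move=> ij; rewrite -lqu lorentz_L2_lt // neq_q.
have [d1 d2] := lag 0.
have l1 : lorentz (u 0) (u 1) = lorentz (u 1) (u 2).
  by rewrite -!lqu; apply: hdist_inj d1; rewrite lqu ltW // gt1.
have l2 : lorentz (u 1) (u 2) = lorentz (u 2) (u 0).
  by rewrite -!lqu; apply: hdist_inj d2; rewrite lqu ltW // gt1.
pose c := - lorentz (u 0) (u 1).
have c1 : 1 < c by exact: gt1.
have cu i j : i != j -> lorentz (u i) (u j) = - c.
  rewrite opprK; apply: (equilateral3 _ (fun i j => lorentz (u i) (u j))) => //.
  by move=> *; exact: lorentzC.
have [y [z [z0 uyz]]] := coplanar_of_equilibrium _ _ _ _ _ hm c1 Lu cu eqm.
apply: (not_coplanar_of_equidistant _ _ _ _ _ c1 _ cu z0 uyz) => i.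
by have [] := Lu i.
Qed.
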